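(* Let $x_0 \in \mathcal{X}_n$ and let $\phi \in C^\infty(\mathbb{R}^d)$. Assume there is $h_0>0$ such that $|\nabla\phi(x)|>0$ for all $x\in B(x_0,h_0)$ and \[ \sup_{x\in B(x_0,h_0)} L(\nabla^2\phi(x), \nabla\phi(x)) < 0 . \] Let $A_1 := -L(\nabla^2\phi(x_0),\nabla\phi(x_0))$. Then there is a positive constant $C$ depending on $\phi$ such that the set $P_h^-[\phi](x_0)$ is nonempty whenever \[ d\theta(x_0) \le \frac{A_1\,\delta}{2|\nabla\phi(x_0)| + C\delta}. \]
   Context: Let $\Omega\subset\mathbb{R}^d$ be open and bounded, and $\mathcal{X}_n=\{x_1,\dots,x_n\}\subset\bar\Omega$ a finite point cloud. Each $x\in\mathcal{X}_n$ has a neighbor set $N_h(x)\subset\mathcal{X}_n$, and there are constants $0<\delta<R$ with $N_h(x)\subset B(x,R)\setminus B(x,\delta)$ for all $x\in\mathcal{X}_n$. Let $V_h(x):=\{y-x: y\in N_h(x)\}$. For nonzero $p,q$ let $w(p,q):=\arccos\left(\frac{p\cdot q}{|p||q|}\right)$, and define the local directional resolution $d\theta(x) := \max_{|p|=1}\min_{q\in V_h(x)} w(p,q)$. For a function $u$ defined on $\mathcal{X}_n$ (or on a superset) and $x\in\mathcal{X}_n$, define \[ P_h^-[u](x) := \{p\in\mathbb{R}^d : -p\in V_h(x), \text{ and for all } y\in N_h(x),\ p\cdot(y-x)<0 \implies u(y)\le u(x)\}. \] For a symmetric matrix $X$ and $p\in\mathbb{R}^d$, $L(X,p) := \sup_{q\cdot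 p = 0,\ |q|=1} q\cdot Xq$.
   Formalization: The formal theorem adds the assumption R ≤ h_0, so that all neighbors of x_0 lie in B(x_0,h_0); without it the claim is false, since far neighbors surrounding x_0 outside this ball with larger values of φ make P_h^-[φ](x_0) empty however small dθ(x_0) is. *)

(* Defs.v *)
From HB Require Import structures.
From mathcomp Require Import all_boot all_order all_algebra.
From mathcomp Require Import all_classical all_reals all_analysis.
Set Implicit Arguments. Unset Strict Implicit. Unset Printing Implicit Defensive.
Import Order.TTheory GRing.Theory Num.Theory.
Import numFieldNormedType.Exports.
Local Open Scope classical_set_scope.
Local Open Scope ring_scope.

Section Defs.
Variables (R : realType) (d : nat).
Notation vec := 'rV[R]_d.

Definition dot (p q : vec) : R := (p *m q^T) 0 0.
Definition enorm (p : vec) : R := Num.sqrt (dot p p).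

Definition eball (x : vec) (r : R) : set vec := [set y | enorm (y - x) < r].

Definition ebasis (i : 'I_d) : vec := \row_j (if j == i then 1 else 0).

Fixpoint iter_partial (l : seq 'I_d) (f : vec -> R) : vec -> R :=
  match l with
  | [::] => f
  | i :: l' => fun x => 'D_(ebasis i) (iter_partial l' f) x
  end.

Definition smooth (f : vec -> R) : Prop :=
  forall l : seq 'I_d,
    continuous (iter_partial l f) /\
    forall (i : 'I_d) (x : vec), derivable (iter_partial l f) x (ebasis i).

Definition grad (f : vec -> R) (x : vec) : vec :=
  \row_i 'D_(ebasis i) f x.
Definition hessian (f : vec -> R) (x : vec) : 'M[R]_d :=
  \matrix_(i, j) 'D_(ebasis i) (fun y => 'D_(ebasis j) f y) x.

Definition Lop (X : 'M[R]_d) (p : vec) : R :=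
  sup [set (q *m X *m q^T) 0 0 | q in [set q : vec | dot q p = 0 /\ enorm q = 1]].

Definition wangle (p q : vec) : R := acos (dot p q / (enorm p * enorm q)).

Definition Vh (N : vec -> set vec) (x : vec) : set vec := [set y - x | y in N x].

(* dtheta(x) = max_{|p|=1} min_{q in V_h(x)} w(p,q), as an extended real
   (a minimum over an empty set is +oo) *)
Definition dtheta (N : vec -> set vec) (x : vec) : \bar R :=
  ereal_sup [set ereal_inf [set (wangle p q)%:E | q in Vh N x]
            | p in [set p : vec | enorm p = 1]].

Definition Pminus (N : vec -> set vec) (u : vec -> R) (x : vec) : set vec :=
  [set p : vec | Vh N x (- p) /\
     forall y, N x y -> dot p (y - x) < 0 -> u y <= u x].

End Defs.

(* Main.v *)
(** Among the neighbour directions let q make the smallest angle with - grad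
  phi(x0); then - q lies in P_h^-. Let y = x0 + r v be a neighbour with v a
  unit vector and q.v > 0, and let e be the unit gradient at x0. Then e.v <
  (e + q/|q|).v <= |e + q/|q|| = 2 sin(alpha/2) <= alpha, where alpha <=
  dtheta(x0) is the angle between q and - e. The third order Taylor
  expansion of phi along x0 + t v gives phi(x0 + t v) <= phi(x0) at t =
  min(delta, eta) for a fixed small eta; the summand C delta in the
  threshold pays for the cubic remainder and for the component of v along e.
  Finally t |-> phi(x0 + t v) has no interior minimum on [0, h0), since its
  critical points have negative second derivative, so the inequality at t
  persists at r >= delta. *)
Require Import Defs.
From HB Require Import structures.
From mathcomp Require Import all_boot all_order all_algebra.
From mathcomp Require Import all_classical all_reals all_analysis.
From mathcomp Require Import ring lra.
Import Order.TTheory GRing.Theory Num.Theory.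
Import numFieldNormedType.Exports.
Local Open Scope classical_set_scope.
Local Open Scope ring_scope.

Set Implicit Arguments.
Unset Strict Implicit.

(** * Calculus on the line: mean values, a cubic Taylor bound, exclusion of interior minima *)

Section RealLine.
Variable R : realType.
Implicit Types (f g : R -> R).

Lemma is_derive1_continuous f f' :
  (forall t : R, is_derive t 1 f (f' t)) -> continuous f.
Proof.
move=> df t; apply: differentiable_continuous; apply/derivable1_diffP.
exact: ex_derive.
Qed.

Lemma is_derive1_MVT f f' a b : a < b ->
  (forall t : R, is_derive t 1 f (f' t)) ->
  exists2 c, a < c < b & f b - f a = f' c * (b - a).
Proof.
move=> ab df.
have [|c] := @MVT R f f' a b ab (fun x _ => df x).
  by apply: continuous_subspaceT; exact: is_derive1_continuous df.
by rewrite in_itv/=; exists c.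
Qed.

Lemma is_derive1_MVT0 f f' h :
  (forall t : R, is_derive t 1 f (f' t)) ->
  exists2 c, `|c| <= `|h| & f h - f 0 = f' c * h.
Proof.
move=> df; have [h0|h0|->] := ltgtP h 0; last first.
- by exists 0 => //; rewrite subrr mulr0.
- have [c /andP[c0 ch] e] := is_derive1_MVT h0 df.
  by exists c; [rewrite !gtr0_norm// ltW|rewrite e subr0].
- have [c /andP[c0 ch] e] := is_derive1_MVT h0 df.
  exists c; first by rewrite !ltr0_norm// lerN2 ltW.
  by rewrite -opprB e sub0r mulrN opprK.
Qed.

Lemma is_derive1_le f g f' g' b :
  (forall t : R, is_derive t 1 f (f' t)) ->
  (forall t : R, is_derive t 1 g (g' t)) ->
  f 0 <= g 0 -> (forall t, 0 <= t <= b -> f' t <= g' t) ->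
  forall t, 0 <= t <= b -> f t <= g t.
Proof.
move=> df dg fg0 fg' t /andP[]; rewrite le_eqVlt => /predU1P[<-//|t0 tb].
have [c /andP[c0 ct]] := is_derive1_MVT t0
  (fun x => is_deriveB (df x) (dg x)).
rewrite !fctE => e; rewrite -subr_le0; move: e => /eqP.
rewrite subr_eq => /eqP ->.
have : f' c <= g' c by apply: fg'; lra.
by move=> h; nra.
Qed.

(** Threefold integration: [p0], [p1], [p2] are Taylor polynomials of [f], [f1], [f2] with third
    derivative replaced by [K], and [is_derive1_le] carries the bound from [f3] up to [f]. *)
Lemma taylor3_le f f1 f2 f3 K b :
  (forall t : R, is_derive t 1 f (f1 t)) ->
  (forall t : R, is_derive t 1 f1 (f2 t)) ->
  (forall t : R, is_derive t 1 f2 (f3 t)) ->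
  (forall t, 0 <= t <= b -> f3 t <= K) ->
  forall t, 0 <= t <= b ->
  f t <= f 0 + f1 0 * t + f2 0 / 2 * t ^+ 2 + K / 6 * t ^+ 3.
Proof.
move=> d1 d2 d3 fK.
pose p2 := (f2 0)%:P + K *: 'X.
pose p1 := (f1 0)%:P + (f2 0) *: 'X + (K / 2) *: 'X^2.
pose p0 := (f 0)%:P + (f1 0) *: 'X + (f2 0 / 2) *: 'X^2 + (K / 6) *: 'X^3.
have pe q q' : (forall t, (deriv q).[t] = q'.[t]) ->
    forall t : R, is_derive t 1 (horner q) q'.[t].
  by move=> e t; rewrite -e; exact: is_derive_poly.
have h2 t : (deriv p2).[t] = (K%:P).[t] by rewrite /p2 !poly.derivE !hornerE.
have h1 t : (deriv p1).[t] = p2.[t].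
  by rewrite /p1 /p2 !poly.derivE !hornerE /=; field.
have h0 t : (deriv p0).[t] = p1.[t].
  by rewrite /p0 /p1 !poly.derivE !hornerE /=; field.
have l2 := is_derive1_le d3 (pe _ _ h2).
have l1 := is_derive1_le d2 (pe _ _ h1).
have l0 := is_derive1_le d1 (pe _ _ h0).
suff h t : 0 <= t <= b -> f t <= p0.[t].
  move=> t tb; have := h t tb; rewrite /p0 !hornerE/=.
  by congr (_ <= _); ring.
apply: l0; first by rewrite /p0 !hornerE /= ?mulr0 ?addr0.
apply: l1; first by rewrite /p1 !hornerE /= ?mulr0 ?addr0.
apply: l2; first by rewrite /p2 !hornerE /= ?mulr0 ?addr0.
by move=> s sb; rewrite hornerE fK.
Qed.

(** If [f r] exceeded [f 0], then [f] would have an interior minimum on [0, r]. There [f1] vanishes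
    and [f2] is negative, so [f1] is negative just to the right, against minimality. *)
Lemma le_init_after_crossing f f1 f2 s r : 0 < s <= r ->
  (forall t : R, is_derive t 1 f (f1 t)) ->
  (forall t : R, is_derive t 1 f1 (f2 t)) ->
  (forall t, 0 < t < r -> f1 t = 0 -> f2 t < 0) ->
  f s <= f 0 -> f r <= f 0.
Proof.
move=> /andP[s0]; rewrite le_eqVlt => /predU1P[<-//|sr] d1 d2 crit fs.
rewrite leNgt; apply/negP => fr.
have r0 : 0 < r by exact: lt_trans sr.
have [|c] := @EVT_min R f 0 r (ltW r0).
  by apply: continuous_subspaceT; exact: is_derive1_continuous d1.
rewrite in_itv/= => /andP[c0 cr] cmin.
(* A minimum at 0 is moved to [s], since [f s <= f 0]; a minimum at [r] is excluded by
   [f s <= f 0 < f r]. *)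
have [m /andP[m0 mr] mmin] :
    exists2 m, 0 < m < r & forall t, 0 <= t <= r -> f m <= f t.
  move: c0; rewrite le_eqVlt => /predU1P[c0|c0].
    exists s; first by rewrite s0.
    by move=> t tr; rewrite (le_trans fs)// c0 cmin.
  exists c => //; rewrite c0/= lt_neqAle cr andbT; apply: contraTneq fr => ec.
  rewrite -leNgt -ec (le_trans _ fs)// cmin//.
  by rewrite in_itv/= !ltW.
have fm0 : f1 m = 0.
  have : is_derive m 1 f 0.
    apply: (@derive1_at_min R f 0 r m (ltW r0)).
    - by move=> t _; exact: ex_derive.
    - by rewrite in_itv/= m0.
    - move=> t; rewrite in_itv/= => /andP[t0 tr].
      by apply: mmin; rewrite !ltW.
  by move=> ?; rewrite -(@derive_val _ _ _ _ _ _ _ (d1 m)) derive_val.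
have f2m : f2 m < 0 by apply: crit => //; rewrite m0.
have : (fun h : R => h^-1 *: ((f1 \o shift m) (h *: 1) - f1 m)) @ 0^' --> f2 m.
  by rewrite -(@derive_val _ _ _ _ _ _ _ (d2 m)); exact: ex_derive.
move=> /cvgrPdist_lt /(_ (- f2 m)); rewrite oppr_gt0 => /(_ f2m).
case/nbhs_ballP => e /= e0 He.
(* The mean value theorem on [m, m + k] will yield [y] with [0 <= f1 y]; the halves keep [y] within
   [e] of [m] and m + k below [r]. *)
pose k := Num.min (e / 2) ((r - m) / 2).
have k0 : 0 < k by rewrite lt_min; apply/andP; split; lra.
have [ke kr] : k <= e / 2 /\ k <= (r - m) / 2.
  by split; rewrite ge_min lexx ?orbT.
have mk : m < m + k by rewrite ltrDl.
have [y /andP[my yk]] := is_derive1_MVT mk d1.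
rewrite addrAC subrr add0r => ey.
have f1y : 0 <= f1 y.
  rewrite -(pmulr_lge0 _ k0) -ey subr_ge0 mmin//; lra.
have := He (y - m); rewrite /ball/= sub0r normrN gtr0_norm ?subr_gt0//.
have ye : y - m < e by lra.
move=> /(_ ye); rewrite subr_eq0 => /(_ (negbT (gt_eqF my))).
rewrite [_ *: 1]mulr1 subrK fm0 subr0 => /ltr_normlP[+ _].
suff : 0 <= (y - m)^-1 *: f1 y by lra.
by rewrite mulr_ge0// invr_ge0 subr_ge0 ltW.
Qed.

End RealLine.

(** * Directional derivatives in a normed space *)

Section Directional.
Variables (R : realType) (V : normedModType R).
Implicit Types (f : V -> R) (x a b : V).

(** Both difference quotients are the same function of h; results on the line thus transfer to
    directional derivatives. *)
Lemma is_derive_line f x a (t l : R) :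
  is_derive t 1 (fun h => f (x + h *: a)) l <-> is_derive (x + t *: a) a f l.
Proof.
have e : (fun h : R => h^-1 *: (((fun h => f (x + h *: a)) \o shift t) (h *: 1)
    - f (x + t *: a))) =
  (fun h : R => h^-1 *: ((f \o shift (x + t *: a)) (h *: a) - f (x + t *: a))).
  by apply/funext => h /=; rewrite [h *: 1]mulr1 scalerDl addrCA addrA.
split => -[d v]; split.
- by move: d; rewrite /derivable e.
- by move: v; rewrite /derive e.
- by move: d; rewrite /derivable e.
- by move: v; rewrite /derive e.
Qed.

Lemma is_derive_scale_dir f x a (c l : R) :
  is_derive x a f l -> is_derive x (c *: a) f (c * l).
Proof.
rewrite -{1 2}[x]addr0 -{1}(scale0r a) -(scale0r (c *: a)).
rewrite -!is_derive_line => d.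
have -> : (fun h : R => f (x + h *: (c *: a))) =
    (fun h => f (x + h *: a)) \o (fun h => h * c).
  by apply/funext => h /=; rewrite scalerA.
rewrite mulrC; apply: is_derive1_comp; first by rewrite /= mul0r.
have -> : *%R^~ c = (c *: (id : R -> R)).
  by apply/funext => h; rewrite /= mulrC.
apply: is_derive_eq (is_deriveZ c (is_derive_id (0 : R) 1)) _.
exact: mulr1.
Qed.

(** The increment is split into a step h a from x and a step h b from x + h a. The mean value
    theorem turns the second quotient into a value of [Db] near x, and continuity of [Db] gives its
    limit. *)
Lemma is_derive_add_dir f a b (Da Db : V -> R) :
  (forall x, is_derive x a f (Da x)) -> (forall x, is_derive x b f (Db x)) ->
  continuous Db ->
  forall x, is_derive x (a + b) f (Da x + Db x).
Proof.
move=> da db cDb x.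
suff lim : (fun h : R => h^-1 *: ((f \o shift x) (h *: (a + b)) - f x)) @ 0^'
    --> Da x + Db x.
  by split; [apply/cvg_ex; eexists; exact: lim | exact: cvg_lim lim].
have -> : (fun h : R => h^-1 *: ((f \o shift x) (h *: (a + b)) - f x)) =
  (fun h : R => h^-1 *: ((f \o shift x) (h *: a) - f x)) \+
  (fun h : R => h^-1 *: (f (x + h *: a + h *: b) - f (x + h *: a))).
  apply/funext => h /=; rewrite -scalerDr; congr (_ *: _).
  rewrite (_ : h *: (a + b) + x = x + h *: a + h *: b).
    by rewrite [h *: a + x]addrC; ring.
  by rewrite scalerDr addrC addrA.
apply: cvgD.
  by rewrite -(@derive_val _ _ _ _ _ _ _ (da x)); exact: ex_derive.
apply/cvgrPdist_lt => e e0.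
have /cvgrPdist_lt /(_ e e0) /nbhs_normP[k /= k0 Hk] := cDb x.
(* The summand 1 keeps the divisor in [hk] positive even when [a] and [b] vanish. *)
have n0 : 0 < `|a| + `|b| + 1 by rewrite ltr_wpDl// addr_ge0.
near=> h.
have [c ch ec] := @is_derive1_MVT0 R (fun t => f (x + h *: a + t *: b))
  (fun t => Db (x + h *: a + t *: b)) h
  (fun t => (is_derive_line f (x + h *: a) b t _).2 (db _)).
rewrite scale0r addr0 in ec; rewrite ec.
have hn0 : h != 0 by near: h; exact: nbhs_dnbhs_neq.
rewrite [_ *: _]mulrC mulfK//; apply: Hk.
rewrite /ball_ /= opprD addrA opprD addrA subrr sub0r -opprD normrN.
have hk : `|h| < k / (`|a| + `|b| + 1).
  by near: h; apply: dnbhs0_lt; rewrite divr_gt0.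
rewrite ltr_pdivlMr// in hk; apply: le_lt_trans hk.
rewrite (le_trans (ler_normD _ _))// !normrZ.
have := normr_ge0 a; have := normr_ge0 b; have := normr_ge0 h.
by nra.
Unshelve. all: by end_near. Qed.

End Directional.

(** * Euclidean inner product and norm on row vectors *)

Section Euclidean.
Variables (R : realType) (d : nat).
Implicit Types (p q v : 'rV[R]_d) (a : R) (M : 'M[R]_d).

Lemma dotE p q : dot p q = \sum_i p 0 i * q 0 i.
Proof. by rewrite /dot mxE; apply: eq_bigr => i _; rewrite mxE. Qed.

Lemma dotC p q : dot p q = dot q p.
Proof. by rewrite !dotE; apply: eq_bigr => i _; rewrite mulrC. Qed.

Lemma dotDl p q v : dot (p + q) v = dot p v + dot q v.
Proof. by rewrite /dot mulmxDl mxE. Qed.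

Lemma dotZl a p v : dot (a *: p) v = a * dot p v.
Proof. by rewrite /dot -scalemxAl mxE. Qed.

Lemma dotNl p v : dot (- p) v = - dot p v.
Proof. by rewrite -scaleN1r dotZl mulN1r. Qed.

Lemma dotDr p q v : dot v (p + q) = dot v p + dot v q.
Proof. by rewrite dotC dotDl !(dotC v). Qed.

Lemma dotZr a p v : dot v (a *: p) = a * dot v p.
Proof. by rewrite dotC dotZl (dotC v). Qed.

Lemma dotvv_ge0 p : 0 <= dot p p.
Proof. by rewrite dotE sumr_ge0// => i _; rewrite -expr2 sqr_ge0. Qed.

Lemma enorm_ge0 p : 0 <= enorm p.
Proof. exact: sqrtr_ge0. Qed.

Lemma enorm_sqr p : enorm p ^+ 2 = dot p p.
Proof. by rewrite sqr_sqrtr// dotvv_ge0. Qed.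

Lemma enormZ a p : enorm (a *: p) = `|a| * enorm p.
Proof.
by rewrite /enorm dotZl dotZr mulrA -expr2 sqrtrM ?sqr_ge0// sqrtr_sqr.
Qed.

Lemma enormN p : enorm (- p) = enorm p.
Proof. by rewrite -scaleN1r enormZ normrN1 mul1r. Qed.

Lemma enorm_normalize p : 0 < enorm p -> enorm ((enorm p)^-1 *: p) = 1.
Proof.
by move=> p0; rewrite enormZ gtr0_norm ?invr_gt0// mulVf// gt_eqF.
Qed.

(** Cauchy-Schwarz, by expanding the squared length of p - (p.v) v. *)
Lemma dot_unit_sqr_le p v : enorm v = 1 -> dot p v ^+ 2 <= dot p p.
Proof.
move=> v1; have vv : dot v v = 1 by rewrite -enorm_sqr v1 expr1n.
have := dotvv_ge0 (p + (- dot p v) *: v).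
rewrite !(dotDl, dotDr, dotZl, dotZr) vv (dotC v p).
by set s := dot p v; nra.
Qed.

Lemma norm_coord_le1 v i : enorm v = 1 -> `|v 0 i| <= 1.
Proof.
move=> v1; rewrite -(@ler_pXn2r _ 2)// ?nnegrE// expr1n real_normK ?num_real//.
have <- : dot v v = 1 by rewrite -enorm_sqr v1 expr1n.
rewrite dotE (bigD1 i)//= -expr2 lerDl sumr_ge0// => j _.
by rewrite -expr2 sqr_ge0.
Qed.

(** Neighbourhoods of row vectors are measured in the maximum norm; this bound places Euclidean
    segments inside them. *)
Lemma mx_norm_le1 v : enorm v = 1 -> `|v| <= 1.
Proof.
move=> v1; change (mx_norm v <= 1).
have [->//|/mx_norm_neq0[[i j] ->]] := eqVneq (mx_norm v) 0.
by rewrite ord1 norm_coord_le1.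
Qed.

Lemma bilinE M p q :
  (p *m M *m q^T) 0 0 = \sum_i \sum_j p 0 i * M i j * q 0 j.
Proof.
rewrite mxE exchange_big /=; apply: eq_bigr => j _.
by rewrite !mxE big_distrl.
Qed.

Lemma bilin_bound M p q :
  (forall i, `|p 0 i| <= 1) -> (forall i, `|q 0 i| <= 1) ->
  `|(p *m M *m q^T) 0 0| <= \sum_i \sum_j `|M i j|.
Proof.
move=> p1 q1; rewrite bilinE (le_trans (ler_norm_sum _ _ _))//.
rewrite ler_sum// => i _.
rewrite (le_trans (ler_norm_sum _ _ _))// ler_sum// => j _.
rewrite !normrM -[leRHS]mulr1 ler_pM// -[leRHS]mul1r ler_pM//.
Qed.

End Euclidean.

(** * Iterated directional derivatives of smooth functions *)

Section Smooth.
Variables (R : realType) (d : nat).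
Implicit Types (f : 'rV[R]_d -> R) (v x : 'rV[R]_d) (l : seq 'I_d).

(** [smooth] supplies derivatives along the basis only; the one along [v] is assembled coordinate by
    coordinate, using continuity of the partials. *)
Lemma is_derive_iter_partial f l v x : smooth f ->
  is_derive x v (iter_partial l f) (\sum_i v 0 i * iter_partial (i :: l) f x).
Proof.
move=> smf.
have cf j : continuous (iter_partial j f) by have [] := smf j.
have df i y : is_derive y (v 0 i *: ebasis R i) (iter_partial l f)
    (v 0 i * iter_partial (i :: l) f y).
  apply: is_derive_scale_dir; exact: derivableP ((smf l).2 i y).
rewrite {1}(row_sum_delta v).
rewrite (eq_bigr (fun i => v 0 i *: ebasis R i)); last first.
  move=> i _; congr (_ *: _); apply/rowP => j.
  by rewrite !mxE eqxx/= ; case: eqP.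
elim: (index_enum _) x => [|i s IH] x.
  rewrite !big_nil; exact: is_derive0.
have -> : \sum_(i <- i :: s) v 0 i * iter_partial (i :: l) f x =
  (fun y => \sum_(i <- s) v 0 i * iter_partial (i :: l) f y) x +
  v 0 i * iter_partial (i :: l) f x.
  by rewrite big_cons addrC.
rewrite big_cons addrC.
apply: (is_derive_add_dir IH (df i)) => y.
by apply: continuousM; [exact: cst_continuous|exact: (cf (i :: l))].
Qed.

(* The n-th directional derivative along v of iter_partial l f, in coordinates. *)
Fixpoint dirD f v n l x : R :=
  if n is m.+1 then \sum_i v 0 i * dirD f v m (i :: l) x
  else iter_partial l f x.

Lemma is_derive_dirD f v n l x : smooth f ->
  is_derive x v (dirD f v n l) (dirD f v n.+1 l x).
Proof.
move=> smf; elim: n l => [|n IH] l; first exact: is_derive_iter_partial.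
have -> : dirD f v n.+1 l = \sum_(i < d) (v 0 i *: dirD f v n (i :: l)).
  by apply/funext => y; rewrite /= fct_sumE.
exact: is_derive_sum.
Qed.

Lemma is_derive_dirD_line f v n x (t : R) : smooth f ->
  is_derive t 1 (fun h => dirD f v n [::] (x + h *: v))
    (dirD f v n.+1 [::] (x + t *: v)).
Proof. by move=> smf; apply/is_derive_line; exact: is_derive_dirD. Qed.

Lemma dirD1E f v x : dirD f v 1 [::] x = dot v (grad f x).
Proof. by rewrite dotE; apply: eq_bigr => i _; rewrite mxE. Qed.

Lemma dirD2E f v x : dirD f v 2 [::] x = (v *m hessian f x *m v^T) 0 0.
Proof.
rewrite bilinE exchange_big /=; apply: eq_bigr => i _.
rewrite big_distrr /=; apply: eq_bigr => j _.
by rewrite mxE/=; ring.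
Qed.

(** The bound is uniform in [v]: coordinates of a unit vector are at most 1 in absolute value, so
    local bounds on the continuous partials simply add up. *)
Lemma dirD_near_bounded f n l x : smooth f ->
  exists K, \forall y \near x, forall v, enorm v = 1 -> `|dirD f v n l y| <= K.
Proof.
move=> smf; elim: n l => [|n IH] l.
  exists (`|iter_partial l f x| + 1).
  have [/(_ x) /cvgrPdist_lt /(_ 1 ltr01)] := smf l.
  move=> H _; near=> y => v _ /=.
  have : `|iter_partial l f x - iter_partial l f y| < 1 by near: y.
  move=> h; rewrite -[X in `|X|](subKr (iter_partial l f x)).
  by rewrite (le_trans (ler_normB _ _))// lerD2l ltW.
have /choice[K HK] := fun i => IH (i :: l).
exists (\sum_i K i); near=> y => v v1 /=.
have H : forall i w, enorm w = 1 -> `|dirD f w n (i :: l) y| <= K i.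
  by near: y; exact: filter_forall.
rewrite (le_trans (ler_norm_sum _ _ _))// ler_sum// => i _.
rewrite normrM -[leRHS]mul1r ler_pM// ?norm_coord_le1//.
exact: H.
Unshelve. all: by end_near. Qed.

End Smooth.

(** * The operator [Lop], angles between directions, and the choice of constants *)

Section Geometry.
Variables (R : realType) (d : nat).
Implicit Types (p q v e : 'rV[R]_d) (M : 'M[R]_d).

(** [sup] defaults to 0 on a set without supremum, so a negative value certifies a genuine one. *)
Lemma sup_lt0_le (S : set R) (x : R) : sup S < 0 -> S x -> x <= sup S.
Proof.
move=> S0 Sx; have [|/sup_out e] := pselect (has_sup S).
  by move=> /sup_upper_bound; apply.
by move: S0; rewrite e ltxx.
Qed.

Lemma quad_le_Lop M p q : Lop M p < 0 -> dot q p = 0 ->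
  (q *m M *m q^T) 0 0 <= Lop M p * dot q q.
Proof.
move=> L0 qp; have := enorm_ge0 q; rewrite le_eqVlt => /predU1P[q0|q0].
  have qq : dot q q = 0 by rewrite -enorm_sqr -q0 expr0n.
  rewrite qq mulr0; suff -> : q = 0 by rewrite !mul0mx mxE.
  apply/rowP => i; rewrite mxE; apply/eqP; rewrite -sqrf_eq0; move: qq.
  rewrite dotE => /psumr_eq0P; rewrite expr2 => -> // j _.
  by rewrite -expr2 sqr_ge0.
set c := (enorm q)^-1.
have : ((c *: q) *m M *m (c *: q)^T) 0 0 <= Lop M p.
  apply: sup_lt0_le => //; exists (c *: q) => //.
  by rewrite /= dotZl qp mulr0 enorm_normalize.
have b u w : (u *m M *m w^T) 0 0 = dot (u *m M) w by [].
rewrite !b -scalemxAl.  rewrite dotZl dotZr mulrA -expr2 -enorm_sqr /c exprVn.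
by rewrite ler_pdivrMl ?exprn_gt0// mulrC.
Qed.

(** Put s = e.v. The vector q = v - s e is orthogonal to e with q.q = 1 - s^2; each of the three
    other terms of the expansion is at most |s| times the entry sum of M, and s^2 <= |s|. *)
Lemma quad_unit_le M e v A : 0 <= A -> enorm e = 1 -> enorm v = 1 ->
  (forall q, dot q e = 0 -> (q *m M *m q^T) 0 0 <= - A * dot q q) ->
  (v *m M *m v^T) 0 0 <=
    - A + (A + 3 * \sum_i \sum_j `|M i j|) * `|dot e v|.
Proof.
move=> A0 e1 v1 He; set B := \sum_i _; set s := dot e v.
have ee : dot e e = 1 by rewrite -enorm_sqr e1 expr1n.
have vv : dot v v = 1 by rewrite -enorm_sqr v1 expr1n.
have s1 : `|s| <= 1.
  have := dot_unit_sqr_le e v1.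
  by rewrite ee -/s -[s ^+ 2]real_normK ?num_real//; nra.
have bb u w : enorm u = 1 -> enorm w = 1 -> `|dot (u *m M) w| <= B.
  move=> u1 w1; apply: bilin_bound => i; exact: norm_coord_le1.
have := He (v + (- s) *: e).
rewrite dotDl dotZl ee dotC -/s mulr1 subrr => /(_ erefl).
have b u w : (u *m M *m w^T) 0 0 = dot (u *m M) w by [].
rewrite !b mulmxDl -scalemxAl !(dotDl, dotDr, dotZl, dotZr) ee vv.
rewrite (dotC v e) -/s.
have := bb e v e1 v1; have := bb v e v1 e1; have := bb e e e1 e1.
set x := dot _ _; set y := dot _ _; set z := dot _ _; set w := dot _ _.
have B0 : 0 <= B by apply: sumr_ge0 => i _; apply: sumr_ge0.
rewrite !ler_norml => /andP[x1 x2] /andP[y1 y2] /andP[z1 z2].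
have h a : - B <= a -> a <= B -> s * a <= `|s| * B.
  move=> a1 a2; rewrite (le_trans (ler_norm _))// normrM ler_wpM2l//.
  by rewrite ler_norml a1.
have ss : s ^+ 2 <= `|s|.
  by rewrite -[s ^+ 2]real_normK ?num_real// expr2 ler_piMr.
have As : A * s ^+ 2 <= A * `|s| by rewrite ler_wpM2l.
have hx : s ^+ 2 * - x <= `|s| * B.
  by apply: le_trans (_ : s ^+ 2 * B <= _);
    [rewrite ler_wpM2l ?sqr_ge0//; lra | rewrite ler_wpM2r].
have hy := h y y1 y2; have hz := h z z1 z2.
lra.
Qed.


Lemma norm_sin_le (x : R) : `|sin x| <= `|x|.
Proof.
have [c _] := is_derive1_MVT0 x (@is_derive_sin R).
by rewrite sin0 subr0 => ->; rewrite normrM ler_piMl// cos_max.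
Qed.

(** By the half-angle formula the left side is 4 sin^2(x/2), the squared chord of an arc x. *)
Lemma one_sub_cos_le (x : R) : 2 - 2 * cos x <= x ^+ 2.
Proof.
rewrite [in cos x](_ : x = x / 2 + x / 2); last by field.
rewrite cosD -!expr2 cos2sin2.
have := norm_sin_le (x / 2).
rewrite -(@ler_pXn2r _ 2)// ?nnegrE// !real_normK ?num_real//.
by lra.
Qed.

(** With alpha the angle, |e + u|^2 = 2 - 2 cos alpha <= alpha^2. Cauchy-Schwarz bounds e.v + u.v by
    alpha, and u.v >= 0 is dropped. *)
Lemma dot_le_wangle e q v : enorm e = 1 -> 0 < enorm q -> enorm v = 1 ->
  0 <= dot q v -> dot e v <= wangle (- e) q.
Proof.
move=> e1 q0 v1 qv.
pose u := (enorm q)^-1 *: q.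
have u1 : enorm u = 1 by exact: enorm_normalize.
have ee : dot e e = 1 by rewrite -enorm_sqr e1 expr1n.
have uu : dot u u = 1 by rewrite -enorm_sqr u1 expr1n.
have uv : 0 <= dot u v by rewrite dotZl mulr_ge0// invr_ge0 ltW.
have -> : wangle (- e) q = acos (- dot e u).
  by rewrite /wangle enormN e1 mul1r dotNl dotZr mulNr mulrC.
have := dot_unit_sqr_le e u1; rewrite ee => eu1.
have [|/andP[a0 _] ca] := @acos_def R (- dot e u).
  by apply/andP; split; nra.
have := one_sub_cos_le (acos (- dot e u)); rewrite ca => h.
have := dot_unit_sqr_le (e + u) v1.
rewrite !(dotDl, dotDr) ee uu (dotC u e) => h2.
have : (dot e v + dot u v) ^+ 2 <= acos (- dot e u) ^+ 2 by lra.
rewrite -ler_sqrt ?sqr_ge0// !sqrtr_sqr (ger0_norm a0) => h3.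
by have := ler_norm (dot e v + dot u v); lra.
Qed.

Lemma finite_lt_bound (T : choiceType) (S : set T) (f : T -> R) (c : R) :
  finite_set S -> (forall x, S x -> c < f x) ->
  exists2 c', c < c' & forall x, S x -> c' <= f x.
Proof.
move=> /finite_seqP[s ->] /=; elim: s => [_|a s IH H].
  by exists (c + 1) => //; rewrite ltrDl.
have [|c' cc' H'] := IH; first by move=> x xs; apply: H; rewrite inE xs orbT.
exists (Num.min (f a) c'); first by rewrite lt_min cc' H// inE eqxx.
move=> x; rewrite inE => /predU1P[->|xs]; first by rewrite ge_min lexx.
by rewrite ge_min H' ?orbT.
Qed.

(** If all angles exceeded [T], finiteness would keep their infimum above some c > T. An empty
    neighbour set, with infimum +oo, falls under the same argument. *)
Lemma dtheta_attained (N : 'rV[R]_d -> set 'rV[R]_d) x (T : R) p :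
  finite_set (N x) -> (dtheta N x <= T%:E)%E -> enorm p = 1 ->
  exists2 q, Vh N x q & wangle p q <= T.
Proof.
move=> fN dT p1; apply: contrapT => H.
have [|c Tc Hc] := @finite_lt_bound _ (Vh N x) (wangle p) T (finite_image _ fN).
  by move=> q Vq; rewrite ltNge; apply/negP => qT; apply: H; exists q.
have : (c%:E <= T%:E)%E.
  apply: le_trans dT; apply: le_trans (ereal_sup_ubound _); last by exists p.
  by apply: le_ereal_inf_tmp => _ [q Vq <-]; rewrite lee_fin Hc.
by rewrite lee_fin leNgt Tc.
Qed.

(* The case s < 0 is handled by t <= G / (B + 1) and t <= A / (K + 1); for
   s >= 0 the bound on s at delta is transferred to t = min(delta, eta), which is why C
   contains 2 G / eta. *)
Lemma resolution_constant (G A B K eta0 : R) :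
  0 < G -> 0 < A -> 0 <= B -> 0 <= K -> 0 < eta0 ->
  exists C, 0 < C /\ forall delta s, 0 < delta ->
    s <= A * delta / (2 * G + C * delta) ->
    exists t, [/\ 0 < t, t <= delta, t <= eta0 &
      G * s + (- A + B * `|s|) / 2 * t + K / 6 * t ^+ 2 <= 0].
Proof.
move=> G0 A0 B0 K0 eta00.
pose eta := Num.min eta0 (Num.min (G / (B + 1)) (A / (K + 1))).
have eta_gt0 : 0 < eta by rewrite !lt_min eta00 !divr_gt0//; lra.
(* Chosen so that C1 A = 2 A B + G K. Since K t <= A, the final bracket is at least 2 C1 A / 3 - A B
   - 2 G K / 3 = A B / 3. *)
pose C1 := 2 * B + G * K / A.
have C10 : 0 <= C1.
  by rewrite addr_ge0 ?mulr_ge0// ?divr_ge0 ?mulr_ge0 ?invr_ge0// ltW.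
pose C := C1 + 2 * G / eta.
have C0 : 0 < C by rewrite ltr_wpDl// divr_gt0// mulr_gt0.
exists C; split=> // delta s d0 sT.
pose t := Num.min delta eta.
have t0 : 0 < t by rewrite lt_min d0.
have td : t <= delta by rewrite ge_min lexx.
have te : t <= eta by rewrite ge_min lexx orbT.
have [t1 [t2 t3]] : t <= eta0 /\ t <= G / (B + 1) /\ t <= A / (K + 1).
  by move: te; rewrite !le_min => /andP[-> /andP[-> ->]].
have B1 : 0 < B + 1 by lra.
have K1 : 0 < K + 1 by lra.
rewrite ler_pdivlMr// in t2; rewrite ler_pdivlMr// in t3.
exists t; split=> //.
have st : s * (2 * G + C1 * t) <= A * t.
  have den : 0 < 2 * G + C * delta by rewrite addr_gt0// mulr_gt0.
  have [s0|s0] := lerP s 0.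
    have : 0 <= 2 * G + C1 * t by nra.
    by nra.
  move: sT; rewrite ler_pdivlMr// => sT.
  (* For t = eta < delta, the summand 2 G / eta of [C] contributes exactly the 2 G delta of the left
     side. *)
  have e : (2 * G + C1 * t) * delta <= (2 * G + C * delta) * t.
    rewrite /C; have [de|ed] := lerP delta eta.
      have -> : t = delta by rewrite /t; apply/min_idPl.
      have : 0 <= 2 * G / eta by rewrite divr_ge0 ?ltW// mulr_gt0.
      by nra.
    have -> : t = eta by rewrite /t; apply/min_idPr; exact: ltW.
    have -> : (2 * G + (C1 + 2 * G / eta) * delta) * eta =
       2 * G * eta + C1 * delta * eta + 2 * G * delta by field; lra.
    by nra.
  by rewrite -(ler_pM2r d0); nra.
have CA : C1 * A = 2 * B * A + G * K by rewrite /C1; field; lra.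
have [s0|s0] := lerP 0 s; last first.
  rewrite ltr0_norm//.
  have : s * (G - B * t / 2) <= 0 by rewrite nmulr_rle0//; lra.
  have : 0 <= t * (A - K * t / 3) by rewrite pmulr_rge0//; lra.
  lra.
rewrite ger0_norm//.
have D0 : 0 < 2 * G + C1 * t by nra.
suff : s * (2 * G + B * t) <= A * t - K * t ^+ 2 / 3 by lra.
rewrite -(ler_pM2r D0).
have -> : s * (2 * G + B * t) * (2 * G + C1 * t) =
    (2 * G + B * t) * (s * (2 * G + C1 * t)) by ring.
have : (2 * G + B * t) * (s * (2 * G + C1 * t)) <= (2 * G + B * t) * (A * t).
  by rewrite ler_wpM2l//; nra.
move=> /le_trans; apply; rewrite -subr_ge0.
have -> : (A * t - K * t ^+ 2 / 3) * (2 * G + C1 * t) -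
    (2 * G + B * t) * (A * t) =
    t ^+ 2 * (C1 * A - A * B - K * t * C1 / 3 - 2 * G * K / 3) by field.
rewrite mulr_ge0 ?sqr_ge0//.
have : K * t * C1 <= A * C1 by rewrite ler_wpM2r//; lra.
nra.
Qed.


End Geometry.

(** * Nonemptiness of [Pminus] at [x0] *)

Unset Implicit Arguments.
Set Strict Implicit.

Theorem theorem1 (R : realType) (d : nat) (phi : 'rV[R]_d -> R) (x0 : 'rV[R]_d)
  (h0 : R) :
  smooth phi ->
  0 < h0 ->
  (forall x, eball x0 h0 x -> 0 < enorm (grad phi x)) ->
  sup [set Lop (hessian phi x) (grad phi x) | x in eball x0 h0] < 0 ->
  let A1 := - Lop (hessian phi x0) (grad phi x0) in
  exists C : R, 0 < C /\
  forall (Omega : set 'rV[R]_d) (X : set 'rV[R]_d) (N : 'rV[R]_d -> set 'rV[R]_d)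
         (delta Rad : R),
    open Omega -> bounded_set Omega ->
    finite_set X -> X `<=` closure Omega ->
    0 < delta -> delta < Rad -> Rad <= h0 ->
    (forall x, X x -> N x `<=` X) ->
    (forall x y, X x -> N x y -> delta <= enorm (y - x) /\ enorm (y - x) < Rad) ->
    X x0 ->
    (dtheta N x0 <= (A1 * delta / (2 * enorm (grad phi x0) + C * delta))%:E)%E ->
    Pminus N phi x0 !=set0.
Proof.
move=> smf h0_gt0 gradpos supL A1.
have enorm_shift x v (t : R) :
    enorm v = 1 -> 0 <= t -> enorm (x + t *: v - x) = t.
  by move=> v1 t0; rewrite addrAC subrr add0r enormZ v1 mulr1 ger0_norm.
have LopI x : eball x0 h0 x -> Lop (hessian phi x) (grad phi x) < 0.
  by move=> xB; apply: le_lt_trans (sup_lt0_le supL _) supL; exists x.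
have x0B : eball x0 h0 x0.
  by rewrite /eball/= subrr /enorm /dot mul0mx mxE sqrtr0.
have A1_gt0 : 0 < A1 by rewrite oppr_gt0 LopI.
set G := enorm (grad phi x0).
have G0 : 0 < G by exact: gradpos.
pose e := G^-1 *: grad phi x0.
have e1 : enorm e = 1 by exact: enorm_normalize.
have gradE : grad phi x0 = G *: e by rewrite scalerA divff ?scale1r// gt_eqF.
have quad_e q : dot q e = 0 ->
    (q *m hessian phi x0 *m q^T) 0 0 <= - A1 * dot q q.
  move=> qe; rewrite opprK; apply: quad_le_Lop; first exact: LopI.
  by rewrite gradE dotZr qe mulr0.
pose B := A1 + 3 * \sum_i \sum_j `|hessian phi x0 i j|.
have B0 : 0 <= B.
  apply: addr_ge0; first exact: ltW.
  by rewrite mulr_ge0// sumr_ge0// => i _; exact: sumr_ge0.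
have [K0 /nbhs_ballP[eps /= eps0 HK0]] := dirD_near_bounded 3 [::] x0 smf.
pose K := Num.max K0 0.
have Kge0 : 0 <= K by rewrite le_max lexx orbT.
have eps2 : 0 < eps / 2 by rewrite divr_gt0.
(* All inputs depend on [phi] and [x0] alone, so [C] is fixed before the point cloud and [delta]. *)
have [C [C0 HC]] := resolution_constant G0 A1_gt0 B0 Kge0 eps2.
exists C; split=> // Omega X N delta Rad _ _ finX _ d0 dR Rh NX Nb Xx0 dT.
have finN : finite_set (N x0) := sub_finite_set (NX _ Xx0) finX.
have eN1 : enorm (- e) = 1 by rewrite enormN.
have [q [y0 Ny0 y0q] wq] := dtheta_attained finN dT eN1.
have q0 : 0 < enorm q.
  by rewrite -y0q; apply: lt_le_trans d0 _; have [] := Nb _ _ Xx0 Ny0.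
exists (- q); split; first by exists y0; rewrite ?opprK.
move=> y Ny; rewrite dotNl oppr_lt0 => qy.
have [dr rR] := Nb _ _ Xx0 Ny.
set r := enorm (y - x0) in dr rR.
have r0 : 0 < r by exact: lt_le_trans dr.
pose v := r^-1 *: (y - x0).
have v1 : enorm v = 1 by exact: enorm_normalize.
have yE : y = x0 + r *: v.
  by rewrite scalerA divff ?gt_eqF// scale1r addrC subrK.
have sT : dot e v <= A1 * delta / (2 * G + C * delta).
  apply: le_trans wq; apply: dot_le_wangle => //.
  by rewrite dotZr mulr_ge0 ?invr_ge0 ?ltW.
have [t [t0 td te Ht]] := HC _ _ d0 sT.
have D n := fun s => is_derive_dirD_line v n x0 s smf.
have phi0 : phi x0 = dirD phi v 0 [::] (x0 + 0 *: v) by rewrite scale0r addr0.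
rewrite {1}yE {1}phi0 -[phi _]/(dirD phi v 0 [::] _).
apply: (@le_init_after_crossing _ (fun h => dirD phi v 0 [::] (x0 + h *: v))
  _ _ t r _ (D 0%N) (D 1%N)).
- by rewrite t0 (le_trans td).
(* At a critical point [v] is orthogonal to the gradient, so [Lop] bounds the second derivative; u <
   r < Rad <= h0 keeps the point where [Lop] is negative. *)
- move=> u /andP[u0 ur]; rewrite dirD1E dirD2E => gu.
  have L0 : Lop (hessian phi (x0 + u *: v)) (grad phi (x0 + u *: v)) < 0.
    apply: LopI; rewrite /eball/= enorm_shift ?ltW//.
    by apply: lt_trans ur _; apply: lt_le_trans Rh.
  apply: le_lt_trans (quad_le_Lop L0 gu) _.
  by rewrite -enorm_sqr v1 expr1n mulr1.
have D3 s : 0 <= s <= t -> dirD phi v 3 [::] (x0 + s *: v) <= K.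
  move=> /andP[s0 st]; rewrite le_max; apply/orP; left.
  apply: le_trans (ler_norm _) _; apply: HK0 => //.
  rewrite -ball_normE /ball_/= opprD addrA subrr sub0r normrN normrZ.
  rewrite ger0_norm//.
  apply: le_lt_trans (_ : eps / 2 < _); last by rewrite ltr_pdivrMr//; lra.
  by rewrite (le_trans (ler_piMr _ (mx_norm_le1 v1)))// (le_trans st).
have := taylor3_le (D 0%N) (D 1%N) (D 2) D3.
move=> /(_ t); rewrite (ltW t0) lexx => /(_ isT) /le_trans; apply.
have HQ := quad_unit_le (ltW A1_gt0) e1 v1 quad_e.
rewrite scale0r addr0 dirD1E dirD2E gradE dotZr dotC.
(* The Taylor polynomial minus phi(x0) has a factor t; [HQ] bounds the remaining bracket by the
   expression in [Ht]. *)
have : t * (G * dot e v + (v *m hessian phi x0 *m v^T) 0 0 / 2 * t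
    + K / 6 * t ^+ 2) <= 0.
  rewrite pmulr_rle0//; apply: le_trans Ht.
  by rewrite lerD2r lerD2l ler_pM2r// ler_pM2r ?invr_gt0.
by rewrite -[dirD _ _ 0 _ _]/(phi x0); lra.
Qed.
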